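(* Let $q$ be a prime power and let $n\ge 2$. The expected number of linear factors of a uniformly random monic degree $n$ square-free polynomial over $F_q$ is $$1-\frac{1}{q}+\frac{1}{q^2}-\frac{1}{q^3}+\cdots\pm\frac{1}{q^{n-2}}=\sum_{i=0}^{n-2}\frac{(-1)^i}{q^i}.$$
   Context: $F_q$ is the finite field with $q$ elements. A random monic degree $n$ square-free polynomial is chosen uniformly from the finite set of monic degree $n$ square-free polynomials with coefficients in $F_q$. The number of linear factors of a polynomial is the number of its monic irreducible factors of degree $1$ over $F_q$. *)

(* Defs.v *)
From mathcomp Require Import all_boot all_order all_algebra.

Set Implicit Arguments.
Unset Strict Implicit.
Unset Printing Implicit Defensive.

Import GRing.Theory.
Local Open Scope ring_scope.

(* Restricting d to size at most [size p] loses nothing, see [square_freeP].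
   With this definition the zero polynomial is not square-free. *)
Definition square_free (F : finFieldType) (p : {poly F}) : bool :=
  [forall d : {poly_(size p) F},
     ((d : {poly F}) ^+ 2 %| p) ==> (size d == 1)%N].

Lemma square_freeP (F : finFieldType) (p : {poly F}) :
  reflect (forall d : {poly F}, d ^+ 2 %| p -> size d = 1%N) (square_free p).
Proof.
apply: (iffP forallP) => [sf_p d d2p | sf_p d]; last first.
  by apply/implyP => /sf_p /eqP.
have [p0 | p_neq0] := eqVneq p 0.
  by have /implyP := sf_p 0; rewrite p0 dvdp0 size_poly0 => /(_ isT).
have d_le : (size d <= size p)%N.
  by apply: dvdp_leq p_neq0 (dvdp_trans _ d2p); apply: dvdp_exp.
by have /implyP/(_ d2p)/eqP := sf_p (NPoly d_le).
Qed.

(* A polynomial of degree n has size n + 1. *)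
Definition monic_square_free (F : finFieldType) (n : nat) :
    {set {poly_(n.+1) F}} :=
  [set p : {poly_(n.+1) F} |
     [&& (p : {poly F}) \is monic, size p == n.+1 & square_free p]].

Definition num_linear_factors (F : finFieldType) (p : {poly F}) : nat :=
  #|[set l : {poly_2 F} |
       [&& (l : {poly F}) \is monic, irreducibleb l, size l == 2 & l %| p]]|.

(* If A is empty this is 0, since 0^-1 = 0 in rat. *)
Definition uniform_expectation (T : finType) (A : {set T}) (X : T -> rat) :
    rat :=
  (\sum_(a in A) X a) / #|A|%:R.

(* Main.v *)
Require Import Defs.
From mathcomp Require Import all_boot all_order all_algebra ring.

(** Write [q] for the number of elements of [F], [s n] for the number of monic
    square-free polynomials of degree [n], and [r n a] for the number of those
    that vanish at [a].  By linearity of expectation the expected number of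
    linear factors is [t n / s n], where [t n] is the sum of [r n a] over [a].

    - Every monic polynomial is uniquely [g * h ^ 2] with [g] monic square-free
      and [h] monic.  Sorting the [q ^ n] monic polynomials of degree [n] by
      [k = deg h] gives [q ^ n = \sum_k q ^ k * s (n - 2 k)].  The terms with
      [k > 0] are [q] times the same sum for [n - 2], so they add up to
      [q ^ (n - 1)], and [s n = q ^ n - q ^ (n - 1)] for [n >= 2]
      ([card_square_free_rec]).

    - Dividing by ['X - a] identifies the square-free polynomials of degree
      [n + 1] vanishing at [a] with those of degree [n] not vanishing at [a]:
      [r (n + 1) a = s n - r n a] ([card_root_square_free]).

    Since [s (n + 1) = q * s n] for [n >= 2], the second relation says that the
    expectation [E n] in degree [n] satisfies [E (n + 1) = 1 - E n / q] for
    [n >= 2].  As [t 2 = s 2], that is [E 2 = 1], the alternating sum follows by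
    induction. *)

Import GRing.Theory.
Local Open Scope ring_scope.

Section SquareFreePolynomials.
Variable F : finFieldType.
Implicit Types (p g h d : {poly F}) (a : F) (n k : nat).

(** * Sizes of monic polynomials *)

Lemma size_mul_monic g h n k : h \is monic ->
  size g = n.+1 -> size h = k.+1 -> size (g * h) = (n + k).+1.
Proof.
move=> h_mon sg sh.
by rewrite size_Mmonic // -?size_poly_gt0 ?sg ?sh // addSn addnS.
Qed.

Lemma monic_sizeS p : p \is monic -> exists k, size p = k.+1.
Proof.
by move=> /monic_neq0; rewrite -size_poly_gt0; case: (size p) => // k; exists k.
Qed.

Lemma size_sqr_monic h k : h \is monic -> size h = k.+1 ->
  size (h ^+ 2) = k.*2.+1.
Proof. by move=> h_mon sh; rewrite expr2 -addnn; apply: size_mul_monic. Qed.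

Lemma monic_size1 p : p \is monic -> size p = 1%N -> p = 1.
Proof.
move=> p_mon sp; apply/eqP; rewrite -eqp_monic ?monic1 //.
by rewrite -size_poly_eq1 sp.
Qed.

(** * The square-free part of a monic polynomial *)

(** Division by squares must stop: if [p] is not square-free, a nonconstant
    square divides it, and after normalising that square to be monic the
    quotient is a monic polynomial of smaller degree. *)
Lemma square_free_decomposition p : p \is monic ->
  exists g h, [/\ g \is monic, h \is monic, square_free g & p = g * h ^+ 2].
Proof.
have [m] := ubnP (size p); elim: m p => // m IHm p /ltnSE-sp p_mon.
have [sf_p | ] := boolP (square_free p).
  by exists p, 1; rewrite p_mon monic1 sf_p expr1n mulr1.
case/forallPn=> d; rewrite negb_imply => /andP[d2p sd].
have p_neq0 := monic_neq0 p_mon.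
have d_neq0 : (d : {poly F}) != 0.
  by apply: contraNneq p_neq0 => d0; move: d2p; rewrite d0 expr0n dvd0p.
pose e := (lead_coef d)^-1 *: (d : {poly F}).
have lc_neq0 : (lead_coef d)^-1 != 0 by rewrite invr_eq0 lead_coef_eq0.
have e_mon : e \is monic by rewrite monicE lead_coefZ mulVf ?lead_coef_eq0.
have se : (1 < size e)%N.
  by rewrite size_scale // ltn_neqAle eq_sym sd size_poly_gt0.
have e2_mon : e ^+ 2 \is monic by rewrite monic_exp.
have e2p : e ^+ 2 %| p by rewrite exprZn dvdpZl // expf_neq0.
have pE := divpK e2p; set c := p %/ _ in pE.
have c_mon : c \is monic by rewrite -(monicMr c e2_mon) pE.
have sc : (size c < m)%N.
  apply: leq_trans sp; rewrite -pE size_Mmonic ?monic_neq0 //.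
  case se_def : (size e) se => [|[|k]] // _.
  rewrite (size_sqr_monic _ k.+1 e_mon se_def) doubleS addnS /= addnS ltnS.
  exact: leq_addr.
have [g [h [g_mon h_mon sf_g cE]]] := IHm c sc c_mon.
exists g, (h * e); split=> //; first by rewrite monicMr.
by rewrite exprMn mulrA -cE pE.
Qed.

(** Cancel [gcdp h h'] from both square roots.  The remaining [u], [u'] are
    coprime and satisfy [g * u ^+ 2 = g' * u' ^+ 2], so [u' ^+ 2] divides [g] and
    [u ^+ 2] divides [g'].  Square-freeness makes [u] and [u'] constant, and then
    the monic [h] and [h'] are associates, hence equal. *)
Lemma square_free_decomposition_unique g h g' h' :
    h \is monic -> h' \is monic -> square_free g -> square_free g' ->
    g * h ^+ 2 = g' * h' ^+ 2 ->
  g = g' /\ h = h'.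
Proof.
move=> h_mon h'_mon sf_g sf_g' eq_p.
have h_neq0 := monic_neq0 h_mon.
pose d := gcdp h h'; pose u : {poly F} := h %/ d; pose u' : {poly F} := h' %/ d.
have hE : h = u * d by rewrite divpK ?dvdp_gcdl.
have h'E : h' = u' * d by rewrite divpK ?dvdp_gcdr.
have d_neq0 : d != 0 by rewrite gcdp_eq0 (negPf h_neq0).
have co_u : coprimep (u ^+ 2) (u' ^+ 2).
  by rewrite coprimep_expl ?coprimep_expr ?coprimep_div_gcd ?h_neq0.
have eq_u : g * u ^+ 2 = g' * u' ^+ 2.
  apply: (mulIf (expf_neq0 2 d_neq0)).
  by have := eq_p; rewrite hE h'E !exprMn !mulrA => ->.
have su' : size u' = 1%N.
  have /square_freeP := sf_g; apply.
  by rewrite -(@Gauss_dvdpl _ g (u ^+ 2)) 1?coprimep_sym // eq_u dvdp_mull ?dvdpp.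
have su : size u = 1%N.
  have /square_freeP := sf_g'; apply.
  by rewrite -(@Gauss_dvdpl _ g' (u' ^+ 2)) // -eq_u dvdp_mull ?dvdpp.
have eq_h : h = h'.
  apply/eqP; rewrite -eqp_monic // hE h'E eqp_mul2r //.
  by apply: (@eqp_trans _ 1); rewrite 1?[1 %= _]eqp_sym -size_poly_eq1 ?su ?su'.
by split=> //; apply: (mulIf (expf_neq0 2 h_neq0)); rewrite {2}eq_h.
Qed.

(** A square dividing ['X - a%:P] times [g] either already divides [g] or is
    divisible by ['X - a%:P] itself; in the latter case ['X - a%:P] must divide
    [g] as well. *)
Lemma square_free_XsubC_mul g a :
  square_free (('X - a%:P) * g) = square_free g && ~~ root g a.
Proof.
apply/square_freeP/andP=> [sf_p | [/square_freeP-sf_g ga_neq0] d d2p].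
  split; first by apply/square_freeP=> d d2g; apply: sf_p; rewrite dvdp_mull.
  apply: contraT => /negPn; rewrite -dvdp_XsubCl => Xa_g.
  have /sf_p : ('X - a%:P) ^+ 2 %| ('X - a%:P) * g.
    by rewrite expr2 dvdp_mul2l ?polyXsubC_eq0.
  by rewrite size_XsubC.
apply: sf_g; rewrite -(@Gauss_dvdpr _ _ ('X - a%:P)) //.
rewrite coprimep_expl // coprimep_XsubC.
apply: contra ga_neq0; rewrite -!dvdp_XsubCl => Xa_d.
rewrite -(@dvdp_mul2l _ ('X - a%:P)) ?polyXsubC_eq0 // -expr2.
by apply: dvdp_trans d2p; apply: dvdp_exp2r.
Qed.

(** * Counting monic square-free polynomials *)

Definition monic_set n (P : pred {poly F}) : {set {poly_n.+1 F}} :=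
  [set p : {poly_n.+1 F} | [&& (p : {poly F}) \is monic, size p == n.+1 & P p]].

Lemma monic_setP n (P : pred {poly F}) (p : {poly_n.+1 F}) :
  reflect [/\ (p : {poly F}) \is monic, size p = n.+1 & P p]
          (p \in monic_set n P).
Proof.
by rewrite inE; apply: (iffP and3P) => [[? /eqP]|[? ->]]; split.
Qed.

Lemma card_monic_set n : #|monic_set n predT| = (#|F| ^ n)%N.
Proof.
pose addXn (r : {poly_n F}) : {poly_n.+1 F} := npolyp n.+1 ('X^n + r).
have sXr (r : {poly_n F}) : (size r < size ('X^n : {poly F}))%N.
  by rewrite size_polyXn ltnS.
have addXnE r : addXn r = 'X^n + r :> {poly F}.
  by rewrite npolypK ?size_polyDl ?sXr ?size_polyXn.
have addXn_inj : injective addXn.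
  move=> r r' /(congr1 (@polyn _ _)); rewrite !addXnE => /addrI.
  exact: val_inj.
rewrite -card_npoly -(card_imset _ addXn_inj); apply: eq_card => p.
apply/monic_setP/imsetP => [[p_mon sp _]|[r _ ->]]; last first.
  rewrite addXnE monicE lead_coefDl ?sXr // lead_coefXn.
  by rewrite size_polyDl ?sXr // size_polyXn.
have sr : (size ((p : {poly F}) - 'X^n)%R <= n)%N.
  apply/leq_sizeP => j le_nj; rewrite coefB coefXn.
  have [->|ne_jn] := eqVneq j n.
    by move/monicP: p_mon; rewrite lead_coefE sp => ->; rewrite subrr.
  by rewrite nth_default ?subr0 // sp ltn_neqAle eq_sym ne_jn.
exists (NPoly sr); first by rewrite inE.
by apply: val_inj; rewrite /= addXnE /= addrC subrK.
Qed.

(** The monic polynomials of degree [n] whose decomposition [g * h ^+ 2] has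
    [h] of degree [k].  This reading requires [k.*2 <= n], since otherwise the
    subtraction is truncated and [npolyp] cuts off the high coefficients. *)
Definition with_square_part n k : {set {poly_n.+1 F}} :=
  [set npolyp n.+1 ((x.2 : {poly F}) * (x.1 : {poly F}) ^+ 2)
    | x : {poly_k.+1 F} * {poly_(n - k.*2).+1 F}
        in setX (monic_set k predT) (monic_set (n - k.*2) (@square_free F))].

Lemma npolyp_mul_sqr n k g h : (k.*2 <= n)%N -> h \is monic ->
    size g = (n - k.*2).+1 -> size h = k.+1 ->
  npolyp n.+1 (g * h ^+ 2) = g * h ^+ 2 :> {poly F}.
Proof.
move=> le_kn h_mon sg sh; rewrite npolypK //.
have sh2 := size_sqr_monic _ _ h_mon sh.
by rewrite (size_mul_monic _ _ _ _ (monic_exp 2 h_mon) sg sh2) subnK.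
Qed.

Lemma card_with_square_part n k : (k.*2 <= n)%N ->
  #|with_square_part n k|
  = (#|F| ^ k * #|monic_set (n - k.*2) (@square_free F)|)%N.
Proof.
move=> le_kn; rewrite card_in_imset ?cardsX ?card_monic_set //.
move=> [h g] [h' g'].
move=> /setXP[/= /monic_setP[h_mon sh _] /monic_setP[_ sg sf_g]].
move=> /setXP[/= /monic_setP[h'_mon sh' _] /monic_setP[_ sg' sf_g']].
move=> /(congr1 (@polyn _ _)); rewrite !(npolyp_mul_sqr _ k) //.
case/(square_free_decomposition_unique _ _ _ _
        h_mon h'_mon sf_g sf_g').
by move=> /val_inj-> /val_inj->.
Qed.

Lemma mem_with_square_part n k (p : {poly_n.+1 F}) : (k.*2 <= n)%N ->
  reflect (exists g h, [/\ [/\ g \is monic, h \is monic & square_free g],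
                         size g = (n - k.*2).+1, size h = k.+1
                       & (p : {poly F}) = g * h ^+ 2])
          (p \in with_square_part n k).
Proof.
move=> le_kn; apply: (iffP imsetP) => [[[h g] /setXP[/= hP gP] ->] | ].
  case/monic_setP: hP gP => h_mon sh _ /monic_setP[g_mon sg sf_g].
  by exists g, h; split; rewrite ?(npolyp_mul_sqr _ k).
case=> g [h [[g_mon h_mon sf_g] sg sh pE]].
exists (npolyp k.+1 h, npolyp (n - k.*2).+1 g).
  by apply/setXP; split; apply/monic_setP; rewrite npolypK ?sg ?sh.
by apply: val_inj; rewrite /= !npolypK ?sg ?sh //= -pE.
Qed.

(** By existence and uniqueness of the decomposition, each monic polynomial of
    degree [n] lies in [with_square_part n k] for exactly one [k <= n./2]; the
    identity is a double count of the pairs of such a polynomial and its [k]. *)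
Lemma sum_card_square_free n :
  (#|F| ^ n = \sum_(k < n./2.+1)
                #|F| ^ k * #|monic_set (n - k.*2) (@square_free F)|)%N.
Proof.
have le_n (k : 'I_(n./2.+1)) : (k.*2 <= n)%N by rewrite -geq_half_double -ltnS.
under eq_bigr => k _ do rewrite -card_with_square_part // -sum1_card big_mkcond.
rewrite exchange_big /= -card_monic_set -sum1_card big_mkcond /=.
apply: eq_bigr => p _; rewrite -big_mkcond sum1_card.
case: monic_setP => [[p_mon sp _] | not_mon]; last first.
  apply/esym/eq_card0 => k; apply: negbTE.
  apply/negP => /mem_with_square_part-/(_ (le_n k)).
  case=> g [h [[g_mon h_mon _] sg sh pE]].
  case: not_mon; rewrite pE monicMr ?monic_exp //; split=> //.
  have sh2 := size_sqr_monic _ _ h_mon sh.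
  by rewrite (size_mul_monic _ _ _ _ (monic_exp 2 h_mon) sg sh2) subnK.
(* The unique index is the degree k of the square root h of the square part. *)
have [g [h [g_mon h_mon sf_g pE]]] := square_free_decomposition p p_mon.
have [m sg] := monic_sizeS _ g_mon; have [k sh] := monic_sizeS _ h_mon.
have sh2 := size_sqr_monic _ _ h_mon sh.
have nE : n = (m + k.*2)%N.
  apply: succn_inj; rewrite -sp pE.
  exact: size_mul_monic (monic_exp 2 h_mon) sg sh2.
have lt_k : (k < n./2.+1)%N by rewrite ltnS geq_half_double nE leq_addl.
rewrite -(card1 (Ordinal lt_k)); apply: eq_card => j.
rewrite unfold_in /= -[RHS]/(p \in with_square_part n j).
apply/eqP/mem_with_square_part => // [-> | [g' [h' [[_ h'm sf_g'] _ sh' pE']]]].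
  by exists g, h; rewrite /= {1}nE addnK.
apply: val_inj => /=; apply: succn_inj; rewrite -sh -sh'.
by have [_ ->] := square_free_decomposition_unique _ _ _ _
  h_mon h'm sf_g sf_g' (etrans (esym pE) pE').
Qed.

Notation s n := #|monic_square_free F n|.

(** In degree 0 or 1 the only possible square part is 1. *)
Lemma card_square_free_small n : (n < 2)%N -> s n = (#|F| ^ n)%N.
Proof.
move=> lt_n2; rewrite sum_card_square_free.
have -> : n./2 = 0%N by case: n lt_n2 => [|[]].
by rewrite big_ord1 mul1n double0 subn0.
Qed.

(** In [sum_card_square_free] for [n.+2], the term [k = 0] is [s n.+2] and the
    others are [#|F|] times the sum for [n]. *)
Lemma card_square_free_rec n :
  (#|F| ^ n.+2 = s n.+2 + #|F| ^ n.+1)%N.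
Proof.
rewrite sum_card_square_free big_ord_recl mul1n subn0; congr (_ + _)%N.
rewrite expnS sum_card_square_free big_distrr /=.
by apply: eq_bigr => k _; rewrite /bump add1n expnS doubleS !subSS mulnA.
Qed.

(** * Roots of square-free polynomials *)

Definition root_square_free n a :=
  monic_set n [pred p | square_free p && root p a].

(** Multiplication by ['X - a%:P] is a bijection from the square-free
    polynomials of degree [n] not vanishing at [a] to those of degree [n.+1]
    vanishing at [a], by [square_free_XsubC_mul]. *)
Lemma card_root_square_free n a :
  (#|root_square_free n.+1 a| + #|root_square_free n a| = s n)%N.
Proof.
rewrite addnC.
rewrite -(cardsID [set p : {poly_n.+1 F} | root p a] (monic_square_free F n)).
congr (_ + _)%N.
  by apply: eq_card => p; rewrite !inE -!andbA.
pose mulX (g : {poly_n.+1 F}) := npolyp n.+2 (('X - a%:P) * (g : {poly F})).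
have mulXE (g : {poly_n.+1 F}) : mulX g = ('X - a%:P) * g :> {poly F}.
  rewrite npolypK //; apply: leq_trans (size_polyMleq _ _) _.
  by rewrite size_XsubC /= ltnS.
have mulX_inj : injective mulX.
  move=> g g' /(congr1 (@polyn _ _)); rewrite !mulXE.
  by move/(mulfI (negbT (polyXsubC_eq0 a)))/val_inj.
rewrite -(card_imset _ mulX_inj); apply: eq_card => p.
have sX : size ('X - a%:P) = 2%N := size_XsubC a.
have Xm := monicXsubC a.
apply/monic_setP/imsetP => [[p_mon sp /andP[sf_p pa]] | [g]]; last first.
  rewrite !inE => /andP[ga /and3P[g_mon /eqP sg sf_g]] ->.
  rewrite mulXE monicMl //; split=> //; last first.
    by rewrite /= square_free_XsubC_mul sf_g ga rootM root_XsubC eqxx.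
  by rewrite mulrC size_Mmonic ?monic_neq0 // sg sX addn2.
have /dvdpP[g pE] : 'X - a%:P %| p by rewrite dvdp_XsubCl.
have g_mon : g \is monic by rewrite -(monicMr _ Xm) -pE.
have sg : size g = n.+1.
  by apply: succn_inj; rewrite -sp pE size_Mmonic ?monic_neq0 // sX addn2.
have [sf_g ga] : square_free g /\ ~~ root g a.
  by apply/andP; rewrite -square_free_XsubC_mul mulrC -pE.
exists (npolyp n.+1 g).
  by rewrite !inE npolypK ?sg // g_mon sf_g ga eqxx.
by apply: val_inj; rewrite /= mulXE npolypK ?sg // pE mulrC.
Qed.

(** Monic linear polynomials are the ['X - a%:P], which are all irreducible. *)
Lemma num_linear_factorsE p : num_linear_factors p = #|[set a | root p a]|.
Proof.
pose X_sub (a : F) := npolyp 2 ('X - a%:P).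
have X_subE a : X_sub a = 'X - a%:P :> {poly F} by rewrite npolypK ?size_XsubC.
have X_sub_inj : injective X_sub.
  move=> a b /(congr1 (@polyn _ _)); rewrite !X_subE => /addrI/oppr_inj.
  exact: polyC_inj.
rewrite -(card_imset _ X_sub_inj); apply: eq_card => l; rewrite inE.
apply/and4P/imsetP => [[l_mon _ /eqP sl lp] | [a]]; last first.
  rewrite inE -dvdp_XsubCl => ap ->; rewrite X_subE monicXsubC size_XsubC ap.
  by split=> //; apply/irreducibleP; apply: irredp_XsubC.
have lE : l = 'X - (- l`_0)%:P :> {poly F}.
  apply/polyP=> i; rewrite coefB coefX coefC.
  case: i => [|[|i]] /=; rewrite ?opprK ?add0r ?subr0 ?oppr0 //.
    by move/monicP: l_mon; rewrite lead_coefE sl.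
  by rewrite nth_default ?sl.
exists (- l`_0); first by rewrite inE -dvdp_XsubCl -lE.
by apply: val_inj; rewrite /= X_subE -lE.
Qed.

Lemma sum_num_linear_factors n :
  (\sum_(p in monic_square_free F n) num_linear_factors p
   = \sum_a #|root_square_free n a|)%N.
Proof.
under eq_bigr => p _ do rewrite num_linear_factorsE -sum1_card big_mkcond.
rewrite exchange_big /=; apply: eq_bigr => a _.
rewrite -big_mkcondr -sum1_card; apply: eq_bigl => p.
by rewrite !inE -!andbA.
Qed.

(** * The expectation *)

Notation t n := (\sum_a #|root_square_free n a|)%N.

Lemma sum_root_rec n : (t n.+1 + t n = #|F| * s n)%N.
Proof.
rewrite -big_split /=; under eq_bigr do rewrite card_root_square_free.
by rewrite sum_nat_const.
Qed.

Lemma sum_root0 : t 0 = 0%N.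
Proof.
apply: big1 => a _; apply/eq_card0 => p; apply: negbTE.
apply/monic_setP => -[p_mon sp /andP[_]].
by rewrite /= (monic_size1 _ p_mon sp) (negPf (root1 a)).
Qed.

Lemma card_square_free_mulq n : s n.+3 = (#|F| * s n.+2)%N.
Proof.
apply/eqP; rewrite -(eqn_add2r (#|F| ^ n.+2)) -card_square_free_rec.
by rewrite [(#|F| ^ n.+2)%N]expnS -mulnDr -card_square_free_rec -expnS.
Qed.

Lemma card_square_free_gt0 n : (0 < s n.+2)%N.
Proof.
have := card_square_free_rec n; rewrite addnC => /esym/eqP.
rewrite -(ltn_add2l (#|F| ^ n.+1)) addn0 => /eqP->.
by rewrite ltn_exp2l ?card_finNzRing_gt1.
Qed.

(** The degree-2 expectation is 1: [t 2 = q * s 1 - t 1 = q ^ 2 - q = s 2]. *)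
Lemma sum_root2 : t 2 = s 2.
Proof.
have t1 := sum_root_rec 0; have t2 := sum_root_rec 1.
rewrite sum_root0 !card_square_free_small // muln1 addn0 in t1 t2.
apply/eqP; rewrite -(eqn_add2r (t 1)) t2 t1; apply/eqP.
exact: card_square_free_rec 0.
Qed.

(** Dividing [t n.+3 = q * s n.+2 - t n.+2] by [s n.+3 = q * s n.+2] turns the
    ratio [x] in degree [n.+2] into [1 - x / q].  The alternating sums obey the
    same recurrence, because after the term [1] of index 0 the rest is [- 1 / q]
    times the shorter sum. *)
Lemma expected_roots n :
  (t n.+2)%:R / (s n.+2)%:R
  = \sum_(0 <= i < n.+1) (-1) ^+ i / #|F|%:R ^+ i :> rat.
Proof.
have neq0 k : (0 < k)%N -> k%:R != 0 :> rat by rewrite Num.Theory.pnatr_eq0 -lt0n.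
have q_neq0 := neq0 _ (ltnW (card_finNzRing_gt1 F)).
elim: n => [|n IHn].
  by rewrite big_nat1 sum_root2 divff ?neq0 ?card_square_free_gt0.
have s_neq0 := neq0 _ (card_square_free_gt0 n).
rewrite big_nat_recl //.
under [in RHS]eq_bigr => i _ do rewrite !exprS invfM mulrACA.
rewrite -mulr_sumr -IHn !expr0.
have := congr1 (fun k => k%:R : rat) (sum_root_rec n.+2).
rewrite natrD => /(canRL (addrK _)) ->; rewrite card_square_free_mulq !natrM.
by field; apply/andP.
Qed.

End SquareFreePolynomials.

Theorem theorem2p3 (F : finFieldType) (q n : nat)
    (hq : #|F| = q) (hn : (2 <= n)%N) :
  uniform_expectation (monic_square_free F n)
    (fun p => (num_linear_factors p)%:R)
  = \sum_(0 <= i < n.-1) (-1) ^+ i / q%:R ^+ i.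
Proof.
case: n hn => [|[|n]] // _.
by rewrite /uniform_expectation -natr_sum sum_num_linear_factors expected_roots hq.
Qed.
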